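(* Let $K$ be a field of characteristic zero, let $G$ be a finite abelian group, let $A=\oplus_{g\in G}A_g$ be a $G$-graded associative $K$-algebra, let $c:G\times G\to K^\times$ be a cocycle, and let $A^c$ be the cocycle twist of $A$ with respect to $c$. Assume that both $A$ and $A^c$ are (two-sided) noetherian. Then $A$ is an FCR-algebra if and only if $A^c$ is an FCR-algebra.
   Context: Algebras are associative unital $K$-algebras. $K^\times=K\setminus\{0\}$. FCR-algebra: an associative $K$-algebra $B$ such that every finite-dimensional representation of $B$ is completely reducible and the intersection of the annihilators of all finite-dimensional representations of $B$ is zero. Cocycle: a map $c:G\times G\to K^\times$ with $c(g,h)c(gh,k)=c(h,k)c(g,hk)$ for all $g,h,k\in G$. Cocycle twist: $A^c=A$ as $G$-graded spaces (write $a^c$ for the element of $A^c$ corresponding to $a\in A$), with multiplication $x^c\circ y^c=c(g,h)(xy)^c$ for $x\in A_g$, $y\in A_h$. *)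

(* Defs.v *)
From HB Require Import structures.
From mathcomp Require Import all_boot all_order all_fingroup all_algebra.

Set Implicit Arguments.
Unset Strict Implicit.
Unset Printing Implicit Defensive.

Import GRing.Theory.
Local Open Scope ring_scope.

(* In a unital algebra, ring ideals are closed under opposites and scaling. *)
Definition left_ideal (R : pzRingType) (I : R -> Prop) : Prop :=
  [/\ I 0, forall x y, I x -> I y -> I (x + y) & forall a x, I x -> I (a * x)].

Definition right_ideal (R : pzRingType) (I : R -> Prop) : Prop :=
  [/\ I 0, forall x y, I x -> I y -> I (x + y) & forall a x, I x -> I (x * a)].

Definition acc (T : Type) (P : (T -> Prop) -> Prop) : Prop :=
  forall I : nat -> T -> Prop,
    (forall n, P (I n)) -> (forall n x, I n x -> I n.+1 x) ->
  exists N, forall n x, (N <= n)%N -> I n x -> I N x.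

Definition noetherian (R : pzRingType) : Prop :=
  acc (@left_ideal R) /\ acc (@right_ideal R).

(* The trivial space V = 0 is allowed. *)
Record representation (K : fieldType) (B : algType K) (V : vectType K) :=
  Representation {
    rep_fun :> {linear B -> 'End(V)};
    rep1 : rep_fun 1 = \1%VF;
    repM : forall a b, rep_fun (a * b) = (rep_fun a \o rep_fun b)%VF
  }.

Definition subrep (K : fieldType) (B : algType K) (V : vectType K)
    (rho : representation B V) (U : {vspace V}) : Prop :=
  forall a, (rho a @: U <= U)%VS.

(* Same convention as mx_completely_reducible in mxrepresentation. *)
Definition completely_reducible (K : fieldType) (B : algType K)
    (V : vectType K) (rho : representation B V) : Prop :=
  forall U, subrep rho U ->
  exists W, [/\ subrep rho W, (U + W = fullv)%VS & (U :&: W = 0)%VS].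

Definition FCR (K : fieldType) (B : algType K) : Prop :=
  (forall (V : vectType K) (rho : representation B V),
     completely_reducible rho) /\
  (forall a : B,
     (forall (V : vectType K) (rho : representation B V), rho a = 0) -> a = 0).

(* That 1 lies in the component of the neutral element is a consequence. *)
Record grading (K : fieldType) (gT : finGroupType) (A : algType K) := Grading {
  homog : gT -> {pred A};
  homog_submod : forall g, submod_closed (homog g);
  homogM : forall g h x y,
    x \in homog g -> y \in homog h -> x * y \in homog (g * h)%g;
  homog_direct : forall x, exists! f : {ffun gT -> A},
    (forall g, f g \in homog g) /\ x = \sum_g f g
}.

Record cocycle (K : fieldType) (gT : finGroupType) := Cocycle {
  cocycle_fun :> gT -> gT -> K;
  cocycle_neq0 : forall g h, cocycle_fun g h != 0;
  cocycleP : forall g h k,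
    cocycle_fun g h * cocycle_fun (g * h)%g k =
    cocycle_fun h k * cocycle_fun g (h * k)%g
}.

Section HomogeneousParts.

Variables (K : fieldType) (gT : finGroupType) (A : algType K).
Variable gr : grading gT A.

Lemma decomp_exists x : exists f : {ffun gT -> A},
  [forall g, f g \in homog gr g] && (x == \sum_g f g).
Proof.
have [f [[fP xE] _]] := homog_direct gr x; exists f.
by rewrite -xE eqxx andbT; apply/forallP.
Qed.

(* pr g x is the component x_g of x. *)
Definition pr (g : gT) (x : A) : A := xchoose (decomp_exists x) g.

Lemma pr_comp g x : pr g x \in homog gr g.
Proof. by have /andP[/forallP/(_ g)] := xchooseP (decomp_exists x). Qed.

Lemma sum_pr x : \sum_g pr g x = x.
Proof. by have /andP[_ /eqP <-] := xchooseP (decomp_exists x). Qed.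

Lemma pr_unique (f : gT -> A) x :
  (forall g, f g \in homog gr g) -> x = \sum_g f g -> forall g, pr g x = f g.
Proof.
move=> fP xE g; have [e [_ eU]] := homog_direct gr x.
have e1 : e = [ffun g => f g].
  apply: eU; split=> [h|]; first by rewrite ffunE.
  by rewrite xE; apply: eq_bigr => h _; rewrite ffunE.
have e2 : e = [ffun g => pr g x].
  apply: eU; split=> [h|]; first by rewrite ffunE pr_comp.
  by rewrite -{1}(sum_pr x); apply: eq_bigr => h _; rewrite ffunE.
by have := congr1 (fun u : {ffun gT -> A} => u g) (etrans (esym e2) e1);
  rewrite !ffunE.
Qed.

Lemma homog0 g : 0 \in homog gr g.
Proof. by have [] := homog_submod gr g. Qed.

Lemma homogZD g a x y :
  x \in homog gr g -> y \in homog gr g -> a *: x + y \in homog gr g.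
Proof. by have [_] := homog_submod gr g; apply. Qed.

Lemma pr_is_linear g : linear (pr g).
Proof.
move=> a x y; apply: (pr_unique (f := fun h => a *: pr h x + pr h y)) => [h|].
  by apply: homogZD; apply: pr_comp.
by rewrite big_split /= -scaler_sumr !sum_pr.
Qed.
HB.instance Definition _ g :=
  GRing.isLinear.Build K A A _ (pr g) (pr_is_linear g).

Lemma pr_homog g h x : x \in homog gr g -> pr h x = if h == g then x else 0.
Proof.
move=> xg; apply: (pr_unique (f := fun h => if h == g then x else 0)).
  by move=> k; case: eqP => [->|_] //; apply: homog0.
by rewrite -big_mkcond big_pred1_eq.
Qed.

Lemma one_comp : 1 \in homog gr 1%g.
Proof.
suff -> : 1 = pr 1%g 1 by apply: pr_comp.
have E g x : x \in homog gr g -> x = pr 1%g 1 * x.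
  move=> xg; have xS : x = \sum_h pr h 1 * x.
    by rewrite -mulr_suml sum_pr mul1r.
  rewrite -{1}[x](_ : pr g x = x); last by rewrite (pr_homog _ xg) eqxx.
  rewrite {1}xS raddf_sum (bigD1 1%g) //= big1 => [|h h1].
    rewrite addr0 (pr_homog _ (homogM (pr_comp _ _) xg)) mul1g eqxx //.
  rewrite (pr_homog _ (homogM (pr_comp _ _) xg)) -{1}(mul1g g).
  by rewrite (inj_eq (mulIg g)) eq_sym (negPf h1).
rewrite -{1}(sum_pr 1) (eq_bigr _ (fun g _ => E g _ (pr_comp g 1))).
by rewrite -mulr_sumr sum_pr mulr1.
Qed.

End HomogeneousParts.

Definition twist (K : fieldType) (gT : finGroupType) (A : algType K)
  (gr : grading gT A) (c : cocycle K gT) : Type := A.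

Section Twist.

Variables (K : fieldType) (gT : finGroupType) (A : algType K).
Variables (gr : grading gT A) (c : cocycle K gT).

Local Notation Ac := (twist gr c).
Local Notation pr := (pr gr).

HB.instance Definition _ := GRing.Lmodule.copy Ac A.

Definition to_twist (x : A) : Ac := x.

Lemma to_twist_is_linear : linear to_twist.
Proof. by []. Qed.
HB.instance Definition _ :=
  GRing.isLinear.Build K A Ac _ to_twist to_twist_is_linear.

(* Bilinear extension of the rule on homogeneous elements. *)
Definition twist_mul (x y : A) : A := \sum_g \sum_h c g h *: (pr g x * pr h y).

(* 1^c need not be the unit of the twist, as c is not assumed normalized. *)
Definition twist_one : A := (c 1%g 1%g)^-1 *: 1.

Lemma cocycle1l k : c 1%g k = c 1%g 1%g.
Proof.
have := cocycleP c 1%g 1%g k; rewrite !mul1g.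
by move/(mulIf (cocycle_neq0 c _ _)).
Qed.

Lemma cocycle1r k : c k 1%g = c 1%g 1%g.
Proof.
have := cocycleP c k 1%g 1%g; rewrite !mulg1.
by move/(mulIf (cocycle_neq0 c _ _)).
Qed.

Lemma twist_mul_homog g h x y : x \in homog gr g -> y \in homog gr h ->
  twist_mul x y = c g h *: (x * y).
Proof.
move=> xg yh; rewrite /twist_mul (bigD1 g) //= (bigD1 h) //=.
rewrite !(pr_homog _ xg) !(pr_homog _ yh) !eqxx !big1 ?addr0 // => i ni.
  by rewrite big1 // => j _; rewrite (pr_homog _ xg) (negPf ni) mul0r scaler0.
by rewrite (pr_homog _ yh) (negPf ni) mulr0 scaler0.
Qed.

Lemma twist_mulDl : left_distributive twist_mul +%R.
Proof.
move=> x y z; rewrite -big_split; apply: eq_bigr => g _ /=.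
rewrite -big_split; apply: eq_bigr => h _ /=.
by rewrite raddfD mulrDl scalerDr.
Qed.

Lemma twist_mulDr : right_distributive twist_mul +%R.
Proof.
move=> x y z; rewrite -big_split; apply: eq_bigr => g _ /=.
rewrite -big_split; apply: eq_bigr => h _ /=.
by rewrite raddfD mulrDr scalerDr.
Qed.

Lemma twist_mulZl a x y : a *: twist_mul x y = twist_mul (a *: x) y.
Proof.
rewrite scaler_sumr; apply: eq_bigr => g _; rewrite scaler_sumr.
apply: eq_bigr => h _; rewrite [pr g (a *: x)]linearZ /= -scalerAl !scalerA.
by rewrite mulrC.
Qed.

Lemma twist_mulZr a x y : a *: twist_mul x y = twist_mul x (a *: y).
Proof.
rewrite scaler_sumr; apply: eq_bigr => g _; rewrite scaler_sumr.
apply: eq_bigr => h _; rewrite [pr h (a *: y)]linearZ /= -scalerAr !scalerA.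
by rewrite mulrC.
Qed.

Lemma twist_mul0l x : twist_mul 0 x = 0.
Proof. by rewrite -[X in twist_mul X _](scale0r 0) -twist_mulZl scale0r. Qed.

Lemma twist_mul0r x : twist_mul x 0 = 0.
Proof. by rewrite -[X in twist_mul _ X](scale0r 0) -twist_mulZr scale0r. Qed.

Lemma twist_mul_suml (F : gT -> A) y :
  twist_mul (\sum_g F g) y = \sum_g twist_mul (F g) y.
Proof.
apply: (big_morph (fun x => twist_mul x y)) => [u v|]; first exact: twist_mulDl.
exact: twist_mul0l.
Qed.

Lemma twist_mul_sumr (F : gT -> A) x :
  twist_mul x (\sum_g F g) = \sum_g twist_mul x (F g).
Proof.
apply: (big_morph (twist_mul x)) => [u v|]; first exact: twist_mulDr.
exact: twist_mul0r.
Qed.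

Lemma twist_mulA : associative twist_mul.
Proof.
move=> x y z.
rewrite -(sum_pr gr x) !twist_mul_suml; apply: eq_bigr => g _.
rewrite -(sum_pr gr y) !(twist_mul_suml, twist_mul_sumr).
apply: eq_bigr => h _; rewrite -(sum_pr gr z) !twist_mul_sumr.
apply: eq_bigr => k _.
have [xg yh zk] := And3 (pr_comp gr g x) (pr_comp gr h y) (pr_comp gr k z).
rewrite (twist_mul_homog yh zk) (twist_mul_homog xg yh).
rewrite -twist_mulZr -twist_mulZl.
rewrite (twist_mul_homog xg (homogM yh zk)) (twist_mul_homog (homogM xg yh) zk).
by rewrite !scalerA cocycleP mulrA.
Qed.

Lemma twist_mul1l : left_id twist_one twist_mul.
Proof.
move=> x; rewrite -{2}(sum_pr gr x) -{1}(sum_pr gr x) twist_mul_sumr.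
apply: eq_bigr => g _; rewrite -twist_mulZl.
rewrite (twist_mul_homog (one_comp gr) (pr_comp gr g x)) mul1r scalerA.
by rewrite cocycle1l mulVf ?scale1r ?cocycle_neq0.
Qed.

Lemma twist_mul1r : right_id twist_one twist_mul.
Proof.
move=> x; rewrite -{2}(sum_pr gr x) -{1}(sum_pr gr x) twist_mul_suml.
apply: eq_bigr => g _; rewrite -twist_mulZr.
rewrite (twist_mul_homog (pr_comp gr g x) (one_comp gr)) mulr1 scalerA.
by rewrite cocycle1r mulVf ?scale1r ?cocycle_neq0.
Qed.

Lemma twist_one_neq0 : twist_one != 0.
Proof. by rewrite scaler_eq0 invr_eq0 negb_or cocycle_neq0 oner_neq0. Qed.

HB.instance Definition _ := GRing.Zmodule_isNzRing.Build Ac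
  twist_mulA twist_mul1l twist_mul1r twist_mulDl twist_mulDr twist_one_neq0.
HB.instance Definition _ := GRing.Lmodule_isLalgebra.Build K Ac twist_mulZl.
HB.instance Definition _ := GRing.Lalgebra_isAlgebra.Build K Ac twist_mulZr.

Lemma to_twistM g h x y : x \in homog gr g -> y \in homog gr h ->
  to_twist x * to_twist y = c g h *: to_twist (x * y).
Proof. exact: twist_mul_homog. Qed.

End Twist.

(* Main.v *)
Require Import Defs.
From HB Require Import structures.
From mathcomp Require Import all_boot all_order all_fingroup all_algebra.

(** A representation of [twist gr c] is a linear map [s : A -> End V] that is
multiplicative up to [c] on homogeneous elements.  Tensoring such a [V] with a
twisted group algebra [K^e G], on which [x] in [A_g] acts by [s x (x) u_g],
replaces [c] by [c e], so one passes freely between representations of [A]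
and of [A^c].  If [U] is a subrepresentation of [V] and [p] is an equivariant
projection of [V (x) K^e G] onto [U (x) K^e G], the diagonal blocks [p_k] of
[p] satisfy [p_(gk) (s x) = (s x) p_k] for [x] in [A_g], hence their average
is an equivariant projection of [V] onto [U].  Faithfulness passes over
because [x] acts on [v (x) u_1] by [\sum_g s (x_g) v (x) u_g] up to nonzero
scalars. *)

Set Implicit Arguments.
Unset Strict Implicit.
Unset Printing Implicit Defensive.

Import GRing.Theory.
Local Open Scope ring_scope.

(** * Complements and equivariant projections *)

Section Projections.

Variables (K : fieldType) (V : vectType K).

Definition stable (T : Type) (s : T -> 'End(V)) (U : {vspace V}) : Prop :=
  forall a, (s a @: U <= U)%VS.

Definition complemented (T : Type) (s : T -> 'End(V)) (U : {vspace V}) : Prop :=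
  exists W, [/\ stable s W, (U + W = fullv)%VS & (U :&: W = 0)%VS].

Lemma stableP (T : Type) (s : T -> 'End(V)) (U : {vspace V}) :
  stable s U <-> forall a v, v \in U -> s a v \in U.
Proof.
split=> [sU a v vU | sU a]; first by apply: (subvP (sU a)); apply: memv_img.
by apply/subvP=> _ /memv_imgP[v vU ->]; apply: sU.
Qed.

(** One direction projects onto [U] along the stable complement [W]; in the other, the kernel of [p]
    is the complement. *)
Lemma complementedP (T : Type) (s : T -> 'End(V)) (U : {vspace V}) :
  stable s U ->
  complemented s U <->
  exists p : 'End(V), [/\ forall v, p v \in U, forall v, v \in U -> p v = v &
    forall a v, p (s a v) = s a (p v)].
Proof.
move=> /stableP sU; split=> [[W [/stableP sW UW UW0]] | [p [pU pid pC]]].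
  have projU v : v \in U -> daddv_pi U W v = v by apply: daddv_pi_id.
  have projW v : v \in W -> daddv_pi U W v = 0.
    (* The two components of [v] sum to [v], and the one in [W] is already [v]. *)
    move=> vW; have := daddv_pi_add UW0 (subvP (addvSr U W) _ vW).
    rewrite (daddv_pi_id _ vW) 1?capvC // => /(canRL (addrK _)).
    by rewrite subrr.
  exists (daddv_pi U W); split=> // [v|a v]; first exact: memv_pi.
  have /memv_addP[u uU [w wW ->]] : v \in (U + W)%VS by rewrite UW memvf.
  rewrite !linearD /= (projU u) // (projW w) // (projU (s a u)) ?sU //.
  by rewrite (projW (s a w)) ?sW // linear0.
exists (lker p); split.
- by apply/stableP=> a v; rewrite !memv_ker pC => /eqP->; rewrite linear0.
- apply/vspaceP=> v; rewrite memvf; apply/memv_addP.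
  exists (p v) => //; exists (v - p v); last by rewrite addrC subrK.
  by rewrite memv_ker linearB /= (pid (p v)) // subrr.
apply/eqP; rewrite -subv0; apply/subvP=> v /memv_capP[vU].
by rewrite memv_ker pid // memv0.
Qed.

End Projections.

(** * The trivial cocycle and quotients of cocycles *)

Section Cocycles.

Variables (K : fieldType) (gT : finGroupType).

Definition cocycle_triv : cocycle K gT :=
  @Cocycle K gT (fun _ _ => 1) (fun _ _ => oner_neq0 K) (fun _ _ _ => erefl).

Lemma cocycle_div_neq0 (d c : cocycle K gT) g h : d g h / c g h != 0.
Proof. by rewrite mulf_neq0 ?invr_eq0 ?cocycle_neq0. Qed.

Lemma cocycle_divP (d c : cocycle K gT) g h k :
  d g h / c g h * (d (g * h)%g k / c (g * h)%g k) =
  d h k / c h k * (d g (h * k)%g / c g (h * k)%g).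
Proof. by rewrite !mulf_div !cocycleP. Qed.

Definition cocycle_div (d c : cocycle K gT) : cocycle K gT :=
  Cocycle (cocycle_div_neq0 d c) (cocycle_divP d c).

End Cocycles.

(** * Twisted representations and change of cocycle *)

Section TwistedRepresentations.

Variables (K : fieldType) (gT : finGroupType) (A : algType K).
Variable gr : grading gT A.
Local Notation pr := (pr gr).

(** The value at 1 reflects that the unit of the twist is [(c 1 1)^-1 *: 1]. Every cocycle is
    handled on the one space [A], so cocycles can be compared without changing algebras. *)
Definition twisted_rep (c : gT -> gT -> K) (V : vectType K)
    (s : A -> 'End(V)) : Prop :=
  s 1 = c 1%g 1%g *: \1%VF /\
  forall g h x y, x \in homog gr g -> y \in homog gr h ->
    (s x \o s y)%VF = c g h *: s (x * y).

Definition twisted_FCR (c : gT -> gT -> K) : Prop :=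
  (forall (V : vectType K) (s : {linear A -> 'End(V)}), twisted_rep c s ->
     forall U, stable s U -> complemented s U) /\
  (forall a, (forall (V : vectType K) (s : {linear A -> 'End(V)}),
     twisted_rep c s -> s a = 0) -> a = 0).

(** * Tensoring with a twisted group algebra *)

Section Induction.

Variables (V : vectType K) (s : {linear A -> 'End(V)}) (e : gT -> gT -> K).

(* [w : {ffun gT -> V}] stands for [\sum_k w k (x) u_k] in [V (x) K^e G]. *)
Definition ind_fun (a : A) (w : {ffun gT -> V}) : {ffun gT -> V} :=
  [ffun k => \sum_g e g (g^-1 * k)%g *: s (pr g a) (w (g^-1 * k)%g)].

Lemma ind_fun_is_linear a : linear (ind_fun a).
Proof.
move=> b u v; apply/ffunP=> k; rewrite !ffunE scaler_sumr -big_split /=.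
apply: eq_bigr => g _; rewrite !ffunE linearP scalerDr !scalerA.
by rewrite [b * _]mulrC.
Qed.
HB.instance Definition _ a :=
  GRing.isLinear.Build K {ffun gT -> V} {ffun gT -> V} _ (ind_fun a)
    (ind_fun_is_linear a).

Definition ind (a : A) : 'End({ffun gT -> V}) := linfun (ind_fun a).

Lemma indE a w k :
  ind a w k = \sum_g e g (g^-1 * k)%g *: s (pr g a) (w (g^-1 * k)%g).
Proof. by rewrite lfunE ffunE. Qed.

Lemma ind_is_linear : linear ind.
Proof.
move=> b x y; apply/lfunP=> w; rewrite add_lfunE scale_lfunE.
apply/ffunP=> k; rewrite [RHS]ffunE [X in _ = X + _]ffunE !indE scaler_sumr.
rewrite -big_split; apply: eq_bigr => g _ /=.
rewrite !linearP /= add_lfunE scale_lfunE scalerDr !scalerA.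
by rewrite [b * _]mulrC.
Qed.
HB.instance Definition _ :=
  GRing.isLinear.Build K A 'End({ffun gT -> V}) _ ind ind_is_linear.

(** Evaluating at [g * k] rather than [k] removes the inverses: only the term of degree [g]
    survives. *)
Lemma ind_homog g x w k : x \in homog gr g ->
  ind x w (g * k)%g = e g k *: s x (w k).
Proof.
move=> xg; rewrite indE (bigD1 g) //= mulKg (pr_homog _ xg) eqxx.
rewrite big1 ?addr0 // => h hg.
by rewrite (pr_homog _ xg) (negPf hg) linear0 zero_lfunE scaler0.
Qed.

End Induction.

(** The second tensor factor contributes [e g h] by the cocycle identity, and [e 1 1] at the unit
    since [e 1 k = e 1 1]. *)
Lemma ind_twisted (V : vectType K) (s : {linear A -> 'End(V)})
    (c d : gT -> gT -> K) (e : cocycle K gT) :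
  (forall g h, d g h = c g h * e g h) ->
  twisted_rep c s -> twisted_rep d (ind s e).
Proof.
move=> dE [s1 sM]; split=> [|g h x y xg yh]; apply/lfunP=> w; apply/ffunP=> k.
  rewrite -[k in LHS]mul1g (ind_homog _ _ _ _ (one_comp gr)) s1.
  by rewrite !scale_lfunE ffunE !id_lfunE cocycle1l scalerA dE mulrC.
rewrite comp_lfunE scale_lfunE ffunE.
(* Each action shifts the index on the left, so this form lets [ind_homog] apply to [x], to [y] and
   to [x * y]. *)
have [l ->] : exists l, k = (g * (h * l))%g.
  by exists (h^-1 * (g^-1 * k))%g; rewrite !mulKVg.
rewrite (ind_homog _ _ _ _ xg) (ind_homog _ _ _ _ yh) linearZ /=.
rewrite -comp_lfunE (sM _ _ _ _ xg yh) scale_lfunE mulgA.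
rewrite (ind_homog _ _ _ _ (homogM xg yh)) !scalerA; congr (_ *: _).
by rewrite dE -[RHS]mulrA cocycleP [RHS]mulrC [e h l * _]mulrC.
Qed.

(** * Diagonal blocks and their average *)

Section Average.

Variables (V : vectType K) (U : {vspace V}).

Definition ffun_proj_fun (w : {ffun gT -> V}) : {ffun gT -> V} :=
  [ffun k => projv U (w k)].

Lemma ffun_proj_fun_is_linear : linear ffun_proj_fun.
Proof. by move=> b u v; apply/ffunP=> k; rewrite !ffunE linearP. Qed.
HB.instance Definition _ :=
  GRing.isLinear.Build K {ffun gT -> V} {ffun gT -> V} _ ffun_proj_fun
    ffun_proj_fun_is_linear.

(** This is [U (x) K^e G]; as the image of the coordinatewise projection it is a subspace by
    construction. *)
Definition ffun_vspace : {vspace {ffun gT -> V}} := limg (linfun ffun_proj_fun).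

Lemma mem_ffun_vspace w : w \in ffun_vspace <-> forall k, w k \in U.
Proof.
split=> [/memv_imgP[v _ ->] k | wU]; first by rewrite lfunE ffunE memv_proj.
suff -> : w = linfun ffun_proj_fun w by apply: memv_img; apply: memvf.
by rewrite lfunE; apply/ffunP=> k; rewrite ffunE projv_id.
Qed.

(** The pure tensor [v (x) u_k]. *)
Definition delta_fun (k : gT) (v : V) : {ffun gT -> V} :=
  [ffun h => if h == k then v else 0].

Lemma delta_fun_is_linear k : linear (delta_fun k).
Proof.
move=> b u v; apply/ffunP=> h; rewrite !ffunE.
by case: eqP => _ //; rewrite scaler0 addr0.
Qed.
HB.instance Definition _ k :=
  GRing.isLinear.Build K V {ffun gT -> V} _ (delta_fun k)
    (delta_fun_is_linear k).

Definition average_fun (p : 'End({ffun gT -> V})) (v : V) : V :=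
  #|gT|%:R^-1 *: \sum_k p (delta_fun k v) k.

Lemma average_fun_is_linear p : linear (average_fun p).
Proof.
move=> b u v; rewrite /average_fun scalerA mulrC -scalerA -scalerDr.
congr (_ *: _); rewrite scaler_sumr -big_split; apply: eq_bigr => k _ /=.
by rewrite !linearP !ffunE.
Qed.
HB.instance Definition _ p :=
  GRing.isLinear.Build K V V _ (average_fun p) (average_fun_is_linear p).

End Average.

Lemma ind_delta (V : vectType K) (s : {linear A -> 'End(V)})
    (e : gT -> gT -> K) g x k v : x \in homog gr g ->
  ind s e x (delta_fun k v) = e g k *: delta_fun (g * k)%g (s x v).
Proof.
move=> xg; apply/ffunP=> m; rewrite -(mulKVg g m) (ind_homog _ _ _ _ xg).
rewrite !ffunE (inj_eq (mulgI g)).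
by case: eqP => [->|_] //; rewrite linear0 !scaler0.
Qed.

(** Equivariance of [p] on [v (x) u_k], read at [u_(gk)], has the factor [e g k] on both sides;
    cancelling it relates block [gk] to block [k], and the sum over blocks absorbs the shift. *)
Lemma average_homog (V : vectType K) (s : {linear A -> 'End(V)})
    (e : cocycle K gT) (p : 'End({ffun gT -> V})) g x v :
  (forall a w, p (ind s e a w) = ind s e a (p w)) -> x \in homog gr g ->
  average_fun p (s x v) = s x (average_fun p v).
Proof.
move=> pC xg; rewrite /average_fun linearZ [in RHS]linear_sum /=.
congr (_ *: _).
rewrite (reindex_inj (mulgI g)); apply: eq_bigr => k _ /=.
have /ffunP/(_ (g * k)%g) := pC x (delta_fun k v).
rewrite (ind_delta _ _ _ _ xg) (ind_homog _ _ _ _ xg) linearZ /= ffunE.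
by apply: scalerI; apply: cocycle_neq0.
Qed.

Hypothesis charK : [pchar K] =i pred0.

(** Each diagonal block of [p] maps into [U] and fixes [U] pointwise, so the average is again a
    projection onto [U]. *)
Lemma complemented_ind (V : vectType K) (s : {linear A -> 'End(V)})
    (e : cocycle K gT) (U : {vspace V}) :
  stable s U -> stable (ind s e) (ffun_vspace U) ->
  complemented (ind s e) (ffun_vspace U) -> complemented s U.
Proof.
move=> sU sU' /(complementedP sU')[p [pU pid pC]].
apply/(complementedP sU); exists (linfun (average_fun p)).
split=> [v | v vU | a v]; rewrite !lfunE /=.
- apply: memvZ; apply: memv_suml => k _.
  by have /mem_ffun_vspace := pU (delta_fun k v); apply.
- rewrite /average_fun (eq_bigr (fun=> v)) => [|k _].
    rewrite sumr_const -scaler_nat scalerA mulVf ?scale1r //.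
    (* Characteristic zero makes the order of the group invertible. *)
    rewrite (pcharf0P K).1 //.
    by rewrite -lt0n; apply/card_gt0P; exists 1%g.
  rewrite pid ?ffunE ?eqxx //; apply/mem_ffun_vspace=> h; rewrite ffunE.
  by case: eqP => // _; apply: mem0v.
rewrite -(sum_pr gr a) linear_sum !sum_lfunE linear_sum /=.
by apply: eq_bigr => g _; apply: average_homog (pr_comp gr g a).
Qed.

(** The two halves induce in opposite directions: reducibility turns [c]-representations into
    [d]-ones through [d / c], faithfulness turns [d]-ones into [c]-ones through [c / d]. *)
Lemma twisted_FCR_change (c d : cocycle K gT) : twisted_FCR d -> twisted_FCR c.
Proof.
move=> [redd resd]; pose e := cocycle_div d c.
have ind_d (V : vectType K) (s : {linear A -> 'End(V)}) :
    twisted_rep c s -> twisted_rep d (ind s e).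
  by apply: ind_twisted => g h; rewrite mulrC divfK ?cocycle_neq0.
split=> [V s sc U sU | a a0].
  have sU' : stable (ind s e) (ffun_vspace U).
    apply/stableP=> a w /mem_ffun_vspace wU; apply/mem_ffun_vspace=> k.
    rewrite indE; apply: memv_suml => g _; apply: memvZ.
    by move/stableP: sU; apply.
  exact: complemented_ind sU sU' (redd _ _ (ind_d _ _ sc) _ sU').
rewrite -(sum_pr gr a) big1 // => g _; apply: resd => V s sd.
have cE h k : c h k = d h k * cocycle_div c d h k.
  by rewrite mulrC divfK ?cocycle_neq0.
apply/lfunP=> v; rewrite zero_lfunE.
(* At [u_g], the image of [v (x) u_1] under [a] is a nonzero multiple of [s (pr g a) v], which
   isolates one component. *)
have /lfunP/(_ (delta_fun 1%g v))/ffunP/(_ g) := a0 _ _ (ind_twisted cE sd).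
rewrite zero_lfunE ffunE indE (bigD1 g) //= mulVg ffunE eqxx.
rewrite big1 ?addr0 => [/eqP|h hg].
  by rewrite scaler_eq0 (negPf (cocycle_div_neq0 _ _ _ _)) => /eqP.
by rewrite ffunE -eq_mulVg1 (negPf hg) linear0 scaler0.
Qed.

End TwistedRepresentations.

(** * Algebras identified with [A] up to a cocycle *)

Section Transport.

Variables (K : fieldType) (gT : finGroupType) (A B : algType K).
Variables (gr : grading gT A) (c : cocycle K gT).
Variables (t : {linear A -> B}) (u : {linear B -> A}).
Hypotheses (tK : cancel t u) (uK : cancel u t).
Hypothesis t1 : t 1 = c 1%g 1%g *: 1.
Hypothesis tM : forall g h x y, x \in homog gr g -> y \in homog gr h ->
  t x * t y = c g h *: t (x * y).

Lemma twisted_rep_of_rep (V : vectType K) (rho : representation B V) :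
  twisted_rep gr c (rho \o t).
Proof.
split=> [|g h x y xg yh] /=; first by rewrite t1 linearZ /= rep1.
by rewrite -repM (tM xg yh) linearZ.
Qed.

Section RepOfTwistedRep.

Variables (V : vectType K) (s : {linear A -> 'End(V)}).
Hypothesis sc : twisted_rep gr c s.

Lemma rep_of_twisted_rep1 : s (u 1) = \1%VF.
Proof.
apply: (scalerI (cocycle_neq0 c 1%g 1%g)); have [<- _] := sc.
by rewrite -!linearZ /= -t1 tK.
Qed.

Lemma rep_of_twisted_repM a b : s (u (a * b)) = (s (u a) \o s (u b))%VF.
Proof.
apply/lfunP=> v; rewrite -{1}(uK a) -{1}(uK b) comp_lfunE.
rewrite -(sum_pr gr (u a)) -(sum_pr gr (u b)).
rewrite !linear_sum mulr_suml !linear_sum !sum_lfunE; apply: eq_bigr => g _ /=.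
rewrite mulr_sumr !linear_sum !sum_lfunE; apply: eq_bigr => h _ /=.
have [xg yh] := (pr_comp gr g (u a), pr_comp gr h (u b)).
rewrite (tM xg yh) linearZ /= tK linearZ -comp_lfunE.
by rewrite (proj2 sc _ _ _ _ xg yh).
Qed.

Definition rep_of_twisted_rep : representation B V :=
  @Representation K B V (s \o u) rep_of_twisted_rep1 rep_of_twisted_repM.

End RepOfTwistedRep.

(** Composing with the bijections [t] and [u] leaves the set of operators unchanged, hence also the
    stable subspaces and their complements. *)
Lemma twisted_FCRP : FCR B <-> twisted_FCR gr c.
Proof.
split=> [[red res] | [red res]]; split.
- move=> V s sc U sU.
  have [a|W [sW UW UW0]] := red V (rep_of_twisted_rep sc) U; first exact: sU.
  by exists W; split=> // a; rewrite -(tK a); apply: sW.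
- move=> a a0; apply: (can_inj tK); rewrite linear0; apply: res => V rho.
  exact: a0 _ _ (twisted_rep_of_rep rho).
- move=> V rho U sU.
  have [a|W [sW UW UW0]] := red V _ (twisted_rep_of_rep rho) U; first exact: sU.
  by exists W; split=> // b; rewrite -(uK b); apply: sW.
move=> b b0; apply: (can_inj uK); rewrite linear0; apply: res => V s sc.
exact: b0 _ (rep_of_twisted_rep sc).
Qed.

End Transport.

(** * Specialization to the twist and to [A] itself *)

Section OfTwist.

Variables (K : fieldType) (gT : finGroupType) (A : algType K).
Variables (gr : grading gT A) (c : cocycle K gT).

Definition of_twist (x : twist gr c) : A := x.

Lemma of_twist_is_linear : linear of_twist.
Proof. by []. Qed.
HB.instance Definition _ :=
  GRing.isLinear.Build K (twist gr c) A _ of_twist of_twist_is_linear.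

Lemma twisted_FCR_twist : FCR (twist gr c) <-> twisted_FCR gr c.
Proof.
apply: (@twisted_FCRP _ _ _ _ gr c (to_twist gr c) of_twist) => //.
  (* The unit on the right is [twist_one], whose scalar cancels [c 1 1]. *)
  by rewrite [RHS]scalerA divff ?cocycle_neq0 // scale1r.
exact: to_twistM.
Qed.

End OfTwist.

(** For the trivial cocycle the identity of [A] serves as both [t] and [u]. *)
Lemma twisted_FCR_untwisted (K : fieldType) (gT : finGroupType) (A : algType K)
  (gr : grading gT A) : FCR A <-> twisted_FCR gr (cocycle_triv K gT).
Proof.
apply: (@twisted_FCRP _ _ _ _ gr _ idfun idfun) => //= [|g h x y _ _].
  by rewrite scale1r.
by rewrite scale1r.
Qed.

Unset Implicit Arguments.

Theorem proposition4p4 (K : fieldType) (charK : [pchar K] =i pred0)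
  (gT : finGroupType) (abG : abelian [set: gT])
  (A : algType K) (gr : grading gT A) (c : cocycle K gT)
  (noethA : noetherian A) (noethAc : noetherian (twist gr c)) :
  FCR A <-> FCR (twist gr c).
Proof.
split=> [/(twisted_FCR_untwisted gr) | /twisted_FCR_twist] fcr.
  by apply/twisted_FCR_twist; apply: twisted_FCR_change fcr.
by apply/(twisted_FCR_untwisted gr); apply: twisted_FCR_change fcr.
Qed.
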